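(* Let $A_1$, $A_2$, and $J$ be three finite sets, each of which contains at least two elements. Let $\sigma_1$ (resp. $\sigma_2$) be a stationary strategy for coordinate $1$ (resp. $2$) that selects all elements in $A_1$ (resp. $A_2$) with positive probability, and let $\nu$ be any probability distribution on $J$. For every $\varepsilon > 0$ there is a mechanism $M = (\tau,J,f)$ that has a finite length (that is, it has length at most $T$ for some $T \in \mathbf{N}$) and that, together with the pair of stationary strategies $(\sigma_1,\sigma_2)$, $\varepsilon$-implements $\nu$ in a strong secure fashion.
   Context: Let $A_1,A_2$ be finite sets. The set of finite histories is $H := \bigcup_{t=0}^\infty (A_1 \times A_2)^t$ (where $(A_1\times A_2)^0$ contains only the empty history), and the set of infinite histories is $H^\infty := (A_1 \times A_2)^\infty$, equipped with the product $\sigma$-algebra. For $t \ge 0$, $\mathcal{F}^t$ is the $\sigma$-algebra on $H^\infty$ generated by the first $t$ entries $(a^1,\dots,a^t)$ of the infinite history $(a^1,a^2,\dots)$. A mechanism is a triplet $M=(\tau,J,f)$ where $\tau$ is a stopping time (possibly taking the value $\infty$) with respect to $(\mathcal{F}^t)_{t\ge 0}$, $J$ is a finite set, and $f: H^\infty \to J$ is measurable with respect to $\mathcal{F}^\tau$. For $i\in\{1,2\}$, a (behavior) strategy for coordinate $i$ is a function $\sigma_i : H \to \Delta(A_i)$, where $\Delta(A_i)$ is the set of probability distributions on $A_i$; $\Sigma_i$ is the set of all such strategies. A strategy is stationary if $\sigma_i(h)$ does not depend on $h\in H$. A pair $(\sigma_1,\sigma_2)$ induces a probability measure $\mathbf{P}_{\sigma_1,\sigma_2}$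 on $H^\infty$ (after each finite history the two coordinates choose the next letters independently according to $\sigma_1$ and $\sigma_2$). Together with a mechanism $M$ it induces the probability distribution $\mathbf{P}_{\sigma_1,\sigma_2,M}(j) := \mathbf{P}_{\sigma_1,\sigma_2}(f=j)$, $j \in J$. A mechanism $M=(\tau,J,f)$ has length at most $T\in\mathbf{N}$ if $\mathbf{P}_{\sigma_1,\sigma_2}(\tau\le T)=1$ for every pair $(\sigma_1,\sigma_2)\in\Sigma_1\times\Sigma_2$. For $\varepsilon\ge 0$ and a probability distribution $\nu$ on $J$, $M$ and $(\sigma_1,\sigma_2)$ $\varepsilon$-implement $\nu$ if $\|\mathbf{P}_{\sigma_1,\sigma_2,M}-\nu\|_\infty\le\varepsilon$. They $\varepsilon$-implement $\nu$ in a strong secure fashion if for every $i\in\{1,2\}$ and every $\sigma'_i\in\Sigma_i$, $M$ and the pair $(\sigma'_i,\sigma_{3-i})$ (coordinate $i$ uses $\sigma'_i$, the other coordinate uses $\sigma_{3-i}$) $\varepsilon$-implement $\nu$. *)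

(* Defs.v *)
From HB Require Import structures.
From mathcomp Require Import all_boot all_order all_algebra.
From mathcomp Require Import all_classical all_reals all_analysis.

Set Implicit Arguments.
Unset Strict Implicit.
Unset Printing Implicit Defensive.
Set Warnings "-redundant-canonical-projection".

Import Order.TTheory GRing.Theory Num.Theory.
Import numFieldNormedType.Exports.

Local Open Scope classical_set_scope.
Local Open Scope ring_scope.

(* The library builds sigma-algebras on pointed types only, so the alphabets   *)
(* are nonempty finite types, given with some element that has no other role. *)
#[short(type="finPointedType")]
HB.structure Definition FinPointed := {T of Finite T & Pointed T}.

HB.instance Definition _ (A B : finPointedType) := Pointed.on (A * B)%type.

Record dist (R : realType) (A : finType) := Dist {
  dist_val :> A -> R ;
  dist_ge0 : forall a, 0 <= dist_val a ;
  dist_sum1 : \sum_(a : A) dist_val a = 1 }.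

Section Plays.
Variable X : finPointedType.

(* The events {w | w k \in B} for the coordinates k in K. *)
Definition coord_events (K : set nat) : set (set (nat -> X)) :=
  \bigcup_(k in K) preimage_set_system [set: nat -> X] (fun w => w k) setT.

(* The infinite sequences over X with the product sigma-algebra, each factor   *)
(* being discrete.                                                             *)
Definition play : Type := g_sigma_algebraType (coord_events setT).
HB.instance Definition _ := Measurable.on play.

(* Coordinates are numbered from 0: the first t entries are w 0, ..., w t.-1. *)
Definition filtration (t : nat) : set (set play) :=
  <<s coord_events [set k | (k < t)%N] >>.

(* None is the value +oo. *)
Definition time := option nat.

Definition time_le (o : time) (t : nat) : bool :=
  if o is Some s then (s <= t)%N else false.

Definition stopping_time (tau : play -> time) : Prop :=
  forall t, filtration t [set w | time_le (tau w) t].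

Definition stopped_algebra (tau : play -> time) : set (set play) :=
  [set E | measurable E /\
           forall t, filtration t (E `&` [set w | time_le (tau w) t])].

Definition cylinder (h : seq X) : set play :=
  [set w | mkseq w (size h) = h].

End Plays.

Section PlayMeasure.
Variables (R : realType) (X : finPointedType).
Variable p : seq X -> X -> R.
Hypothesis p_ge0 : forall h x, 0 <= p h x.
Hypothesis p_sum1 : forall h, \sum_(x : X) p h x = 1.

Definition path_prob (h : seq X) : R :=
  \prod_(k < size h) p (take k h) (nth point h k).

(* Existence of the induced measure: splitting [0, 1[ into consecutive         *)
(* intervals I h of length path_prob h, nested along histories, yields a map   *)
(* itinerary : R -> play X that carries Lebesgue measure to it.                *)
Let c (h : seq X) (i : nat) : R := \sum_(y | (enum_rank y < i)%N) p h y.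
Let lo (h : seq X) : R :=
  \sum_(k < size h) path_prob (take k h) *
    c (take k h) (enum_rank (nth point h k)).
Let I (h : seq X) : set R := `[lo h, lo h + path_prob h[.

Let path_prob_ge0 h : 0 <= path_prob h.
Proof. by apply: prodr_ge0. Qed.

Let path_prob_rcons h x : path_prob (rcons h x) = path_prob h * p h x.
Proof.
rewrite /path_prob size_rcons big_ord_recr/= nth_rcons ltnn eqxx.
rewrite -cats1 take_size_cat//; congr (_ * _); apply: eq_bigr => k _.
by rewrite nth_cat ltn_ord takel_cat// ltnW.
Qed.

Let lo_rcons h x : lo (rcons h x) = lo h + path_prob h * c h (enum_rank x).
Proof.
rewrite /lo size_rcons big_ord_recr/= nth_rcons ltnn eqxx.
rewrite -cats1 take_size_cat//; congr (_ + _); apply: eq_bigr => k _.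
by rewrite nth_cat ltn_ord takel_cat// ltnW.
Qed.

Let c0 h : c h 0 = 0.
Proof. by rewrite /c big_pred0. Qed.

Let cT h : c h #|X| = 1.
Proof. by rewrite -(p_sum1 h) /c; apply: eq_bigl => y; rewrite ltn_ord. Qed.

Let cS h x : c h (enum_rank x).+1 = c h (enum_rank x) + p h x.
Proof.
rewrite /c (bigD1 x)/= ?ltnS// addrC; congr (_ + _); apply: eq_bigl => y.
rewrite ltnS [RHS]ltn_neqAle andbC; congr (_ && _).
by rewrite -(inj_eq enum_rank_inj) -val_eqE.
Qed.

Let g h i := lo h + path_prob h * c h i.

Let le_g h i j : (i <= j)%N -> g h i <= g h j.
Proof.
move=> ij; rewrite lerD2l ler_wpM2l// /c [leRHS](bigID (fun y => enum_rank y < i)%N)/=.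
rewrite [X in _ <= X + _](eq_bigl (fun y => enum_rank y < i)%N) ?lerDl ?sumr_ge0//.
by move=> y; rewrite andb_idl// => /leq_trans; exact.
Qed.

Let I_rcons h x : I (rcons h x) = `[g h (enum_rank x), g h (enum_rank x).+1[%classic.
Proof. by rewrite /I /g lo_rcons path_prob_rcons cS mulrDr addrA. Qed.

Let IE h : I h = `[g h 0, g h #|X|[%classic.
Proof. by rewrite /I /g c0 cT mulr0 mulr1 addr0. Qed.

Let I_sub h x : I (rcons h x) `<=` I h.
Proof.
rewrite I_rcons IE => u /=; rewrite !in_itv/= => /andP[gu ug].
by rewrite (le_trans _ gu) ?le_g//= (lt_le_trans ug)// le_g.
Qed.

Let I_ex h u : I h u -> exists x, I (rcons h x) u.
Proof.
rewrite IE /= in_itv/= => /andP[g0u ugN].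
have ex : exists i, u < g h i by exists #|X|.
case: (ex_minnP ex) => -[|k] ugk kmin; first by rewrite ltNge g0u in ugk.
have kX : (k < #|X|)%N by exact: kmin.
exists (enum_val (Ordinal kX)); rewrite I_rcons enum_valK/= in_itv/= ugk andbT.
by rewrite leNgt; apply/negP => /kmin; rewrite ltnn.
Qed.

Let I_inj h u x y : I (rcons h x) u -> I (rcons h y) u -> x = y.
Proof.
wlog xy : x y / (enum_rank x <= enum_rank y)%N.
  move=> W Ix Iy; have [xy|/ltnW yx] := leqP (enum_rank x) (enum_rank y).
    exact: W.
  by apply/esym/W.
rewrite !I_rcons/= !in_itv/= => /andP[_ ux] /andP[uy _].
apply: enum_rank_inj; apply: val_inj; apply/eqP; rewrite eqn_leq xy/= leqNgt.
by apply/negP => /(le_g h); rewrite leNgt (le_lt_trans uy ux).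
Qed.

Let next u h : X := xget point [set x | I (rcons h x) u].
Let prefix u n : seq X := iter n (fun h => rcons h (next u h)) [::].
Let itinerary u : play X := fun n => next u (prefix u n).

Let mkseq_itinerary u n : mkseq (itinerary u) n = prefix u n.
Proof. by elim: n => // n IH; rewrite mkseqS IH. Qed.

Let I0E : I [::] = `[0, 1[%classic.
Proof. by rewrite /I /lo /path_prob !big_ord0 add0r. Qed.

Let I_prefix u n : I [::] u -> I (prefix u n) u.
Proof.
move=> u0; elim: n => // n /I_ex [x Ix] /=.
by rewrite /next; case: xgetP => [y -> //|/(_ x)].
Qed.

Let prefix_I u h : I h u -> prefix u (size h) = h.
Proof.
elim/last_ind: h => // h x IH Ix; rewrite size_rcons/= IH; last exact: I_sub Ix.
congr rcons; rewrite /next; case: xgetP => [y _ Iy|/(_ x)//].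
exact: I_inj Iy Ix.
Qed.

Let I_sub0 h : I h `<=` I [::].
Proof. by elim/last_ind: h => // h x IH u /I_sub/IH. Qed.

Let itineraryE h : I [::] `&` itinerary @^-1` cylinder h = I h.
Proof.
apply/seteqP; split => u /=; rewrite /cylinder/= mkseq_itinerary.
  by move=> [u0 <-]; exact: I_prefix.
by move=> Iu; split; [exact: I_sub0 Iu|exact: prefix_I].
Qed.

Let measurable_I h : measurable (I h).
Proof. exact: measurable_itv. Qed.

Let measurable_itinerary : measurable_fun (I [::]) itinerary.
Proof.
apply: (@measurability _ _ R (play X) _ _ (coord_events setT)) => // _ [_ [k _ [B _ <-]] <-].
rewrite (_ : _ `&` _ =
    \bigcup_(h in [set h : seq X | size h = k.+1 /\ B (nth point h k)]) I h).
  rewrite bigcup_mkcond; apply: countable_bigcupT_measurable => // h.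
  by case: ifP => // _; exact: measurable_I.
apply/seteqP; split => [u [u0 /= [_ Bu]]|u [h [hk Bh] Iu]].
  exists (prefix u k.+1); last exact: I_prefix.
  by rewrite -mkseq_itinerary; split; [rewrite size_mkseq|rewrite nth_mkseq].
split; first exact: I_sub0 Iu.
rewrite /=; split=> //.
by rewrite -(nth_mkseq point _ (ltnSn k)) mkseq_itinerary -hk prefix_I.
Qed.

Let mu (E : set (play X)) : \bar R :=
  lebesgue_measure (I [::] `&` itinerary @^-1` E).

Let mu0 : mu set0 = 0%E.
Proof. by rewrite /mu preimage_set0 setI0 measure0. Qed.

Let mu_ge0 E : (0 <= mu E)%E.
Proof. exact: measure_ge0. Qed.

Let mu_sigma_additive : semi_sigma_additive mu.
Proof.
move=> F mF tF mUF; rewrite /mu preimage_bigcup setI_bigcupr.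
apply: measure_semi_sigma_additive.
- by move=> n; exact: measurable_itinerary.
- apply/trivIsetP => /= i j _ _ ij; rewrite setIACA setIid -preimage_setI.
  by move/trivIsetP : tF => /(_ _ _ _ _ ij) ->//; rewrite preimage_set0 setI0.
- by rewrite -setI_bigcupr -preimage_bigcup; exact: measurable_itinerary.
Qed.

#[local] HB.instance Definition _ :=
  isMeasure.Build _ _ _ mu mu0 mu_ge0 mu_sigma_additive.

Let mu_setT : mu setT = 1%E.
Proof.
by rewrite /mu preimage_setT setIT I0E lebesgue_measure_itv/= lte_fin ltr01 oppr0 adde0.
Qed.

#[local] HB.instance Definition _ := Measure_isProbability.Build _ _ _ mu mu_setT.

Lemma play_measure_exists :
  exists P : probability (play X) R,
    forall h, P (cylinder h) = (path_prob h)%:E.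
Proof.
exists mu => h; rewrite /= /mu itineraryE /I lebesgue_measure_itv/= lte_fin.
case: ltP => [_|]; first by rewrite -EFinB addrAC subrr add0r.
rewrite gerDl => Q0; congr EFin; apply/eqP.
by rewrite eq_le Q0 path_prob_ge0.
Qed.

End PlayMeasure.

Section PlayMeasureUnique.
Variable X : finPointedType.

Lemma cylinder_nil : cylinder [::] = [set: play X].
Proof. by rewrite -subTset. Qed.

Lemma cylinderI (h h' : seq X) : (size h <= size h')%N ->
  cylinder h `&` cylinder h' = if take (size h) h' == h then cylinder h' else set0.
Proof.
move=> hh'; have E (w : play X) : cylinder h' w -> mkseq w (size h) = take (size h) h'.
  move=> <-; apply: (@eq_from_nth _ point) => [|i].
    by rewrite size_takel ?size_mkseq.
  by rewrite size_mkseq => ih; rewrite nth_take// !nth_mkseq// (leq_trans ih).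
case: ifPn => [/eqP hE|/eqP hN]; apply/seteqP; split => w //=.
- by case.
- by move=> h'w; split => //; rewrite /cylinder/= (E _ h'w).
- by case=> hw /E; rewrite hw => /esym/hN.
Qed.

Definition cylinders : set (set (play X)) :=
  [set E | E = set0 \/ exists h : seq X, E = cylinder h].

Lemma cylinders_setI_closed : setI_closed cylinders.
Proof.
move=> A B [->|[h ->]] [->|[h' ->]]; rewrite ?(set0I, setI0); try by left.
have [hh'|/ltnW hh'] := leqP (size h) (size h').
  by rewrite cylinderI//; case: ifP => _; [right; exists h'|left].
by rewrite setIC cylinderI//; case: ifP => _; [right; exists h|left].
Qed.

Lemma coord_event_cylinders k (B : set X) :
  [set w : play X | B (w k)] =
  \bigcup_(h in [set h : seq X | size h = k.+1 /\ B (nth point h k)]) cylinder h.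
Proof.
apply/seteqP; split => [w Bw|w [h [hk Bh] hw] /=].
  exists (mkseq w k.+1); last by rewrite /cylinder /mkset size_mkseq.
  by split; [rewrite size_mkseq|rewrite nth_mkseq].
by rewrite -(nth_mkseq point w (ltnSn k)) -hk hw.
Qed.

Lemma cylinder_coord_events (h : seq X) :
  cylinder h = \bigcap_(k in [set k | (k < size h)%N])
    [set w : play X | w k = nth point h k].
Proof.
apply/seteqP; split => [w hw k /= kh|w hw].
  by rewrite -[in RHS](hw : mkseq w _ = h) nth_mkseq.
apply: (@eq_from_nth _ point); rewrite size_mkseq// => k kh.
by rewrite nth_mkseq// (hw k kh).
Qed.

Lemma measurable_coord_event k (B : set X) : measurable [set w : play X | B (w k)].
Proof.
by apply: sub_sigma_algebra; exists k => //; exists B => //; rewrite setTI.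
Qed.

Lemma measurable_cylinder (h : seq X) : measurable (cylinder h).
Proof.
rewrite cylinder_coord_events; apply: bigcap_measurableType => k _.
exact: (measurable_coord_event k [set nth point h k]).
Qed.

Lemma measurable_play_cylinders : @measurable _ (play X) = <<s cylinders >>.
Proof.
apply/seteqP; split; apply: smallest_sub; try exact: smallest_sigma_algebra.
- move=> _ [k _ [B _ <-]]; rewrite setTI.
  have -> : (fun w : nat -> X => w k) @^-1` B = [set w : play X | B (w k)] by [].
  rewrite coord_event_cylinders.
  rewrite bigcup_mkcond.
  apply: (@countable_bigcupT_measurable _ (g_sigma_algebraType cylinders)) => // h.
  by case: ifP => // _; apply: sub_sigma_algebra; right; exists h.
- by move=> _ [->|[h ->]]; [exact: measurable0|exact: measurable_cylinder].
Qed.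

Lemma play_measure_unique (R : realType) (P Q : probability (play X) R) :
  (forall h, P (cylinder h) = Q (cylinder h)) ->
  forall E, measurable E -> P E = Q E.
Proof.
move=> PQ E mE; apply: (measure_unique cylinders (fun=> setT)) => //.
- exact: measurable_play_cylinders.
- exact: cylinders_setI_closed.
- by move=> _; right; exists [::]; rewrite cylinder_nil.
- by apply/seteqP; split => // w _; exists 0%N.
- move=> _ [->|[h ->]]; last exact: PQ.
  by rewrite (measure0 P) (measure0 Q).
- by move=> _; rewrite [ltLHS](probability_setT P) ltry.
Qed.

End PlayMeasureUnique.

Section Game.
Variables (R : realType) (A1 A2 : finPointedType).

Definition history : Type := seq (A1 * A2).

Definition strategy (A : finType) : Type := history -> dist R A.

Definition stationary (A : finType) (s : strategy A) : Prop :=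
  forall h h', s h = s h'.

Definition full_support (A : finType) (s : strategy A) : Prop :=
  forall h a, 0 < s h a.

Definition next_prob (s1 : strategy A1) (s2 : strategy A2)
    (h : history) (x : A1 * A2) : R :=
  s1 h x.1 * s2 h x.2.

Lemma next_prob_ge0 s1 s2 h x : 0 <= next_prob s1 s2 h x.
Proof. by rewrite mulr_ge0 ?dist_ge0. Qed.

Lemma next_prob_sum1 s1 s2 h : \sum_x next_prob s1 s2 h x = 1.
Proof.
rewrite -(pair_bigA _ (fun a b => s1 h a * s2 h b))/=.
under eq_bigr do rewrite -mulr_sumr dist_sum1 mulr1.
exact: dist_sum1.
Qed.

(* The measure induced by (s1, s2): the one probability on plays for which a   *)
(* finite history has the product of its conditional probabilities             *)
(* (play_probE; unique by play_measure_unique).                                *)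
Definition play_prob (s1 : strategy A1) (s2 : strategy A2) :
    probability (play (A1 * A2)%type) R :=
  sval (cid (play_measure_exists (next_prob_ge0 s1 s2) (next_prob_sum1 s1 s2))).

Lemma play_probE s1 s2 (h : history) :
  play_prob s1 s2 (cylinder h) = (path_prob (next_prob s1 s2) h)%:E.
Proof. by rewrite /play_prob; case: cid. Qed.

Record mechanism (J : finType) := Mechanism {
  mech_time : play (A1 * A2)%type -> time ;
  mech_out : play (A1 * A2)%type -> J ;
  mech_stopping : stopping_time mech_time ;
  mech_measurable : forall B : set J,
    stopped_algebra mech_time (mech_out @^-1` B) }.

Definition length_at_most (J : finType) (M : mechanism J) (T : nat) : Prop :=
  forall s1 s2, play_prob s1 s2 [set w | time_le (mech_time M w) T] = 1%E.

Definition mech_prob (J : finType) (M : mechanism J) s1 s2 (j : J) : R :=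
  fine (play_prob s1 s2 [set w | mech_out M w = j]).

Definition implements (J : finType) (M : mechanism J) s1 s2
    (nu : dist R J) (eps : R) : Prop :=
  \big[Num.max/0]_(j : J) `|mech_prob M s1 s2 j - nu j| <= eps.

Definition secure_implements (J : finType) (M : mechanism J) s1 s2
    (nu : dist R J) (eps : R) : Prop :=
  (forall s1', implements M s1' s2 nu eps) /\
  (forall s2', implements M s1 s2' nu eps).

End Game.

(* Main.v *)
(* Fix letters a0, b0 and let g(a,b) = (1[a = a0] - s1(a0)) (1[b = b0] - s2(b0)). *)
(* Whatever one coordinate does, g has conditional mean 0 as long as the other  *)
(* one plays its stationary law, while g^2 is bounded below pointwise because   *)
(* both laws have full support and two letters at least. The mechanism runs a   *)
(* walk m in the simplex over J from nu: as long as two coordinates i, j of m   *)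
(* exceed d, it moves mass d g from j to i. So m is a martingale, and |m|^2 <= 1 *)
(* grows in mean by a constant at each such step, hence the walk freezes by     *)
(* a large time T with probability close to 1. Then m is close to a vertex,     *)
(* which is the outcome; E m_T = nu gives its law.                              *)

Require Import Defs.
From mathcomp Require Import all_boot all_order all_algebra.
From mathcomp Require Import all_classical all_reals all_analysis.
From mathcomp Require Import ring lra.

Set Implicit Arguments.
Unset Strict Implicit.
Unset Printing Implicit Defensive.

Import Order.TTheory GRing.Theory Num.Theory.

Local Open Scope classical_set_scope.
Local Open Scope ring_scope.

(** Against any deviation the next two letters stay independent, so the conditional mean of [g] is a
    product of two factors. The factor of the non-deviating coordinate vanishes by [bias_mean0].
    Hence [state] is a martingale with mean [nu] ([expect_state]). Its squared norm gains in mean at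
    least [d ^+ 2 * c *+ 2] at each unsettled step and never exceeds 1, so being unsettled at a late
    time is unlikely ([expect_unsettled]). A settled state is within [#|J|%:R * d] of a vertex in
    each coordinate ([decide_error]). Averaging that bound compares the law of the outcome with [nu]
    ([decide_prob_error]), uniformly in the deviation. *)

(** * Events determined by a finite prefix *)

Section PrefixEvents.
Variable X : finPointedType.

Lemma prefix_event_cylinders n (D : set (seq X)) :
  [set w : play X | D (mkseq w n)] =
  \bigcup_(h in [set h : n.-tuple X | D h]) cylinder (val h).
Proof.
apply/seteqP; split => [w Dw|w [h Dh]].
  have szw : size (mkseq w n) == n by rewrite size_mkseq.
  by exists (Tuple szw) => //; rewrite /cylinder /mkset /= size_mkseq.
by rewrite /cylinder /mkset size_tuple => ->.
Qed.

Lemma filtration_prefix_event n t (D : set (seq X)) : (n <= t)%N ->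
  filtration t [set w : play X | D (mkseq w n)].
Proof.
move=> nt; rewrite prefix_event_cylinders.
apply: (@fin_bigcup_measurable _
  (g_sigma_algebraType (@coord_events X [set k | (k < t)%N]))) => // h _.
rewrite cylinder_coord_events; apply: bigcap_measurableType => k /= kn.
apply: sub_sigma_algebra; exists k.
  by rewrite /= (leq_trans _ nt)// -[n in (_ < n)%N](size_tuple h).
by exists [set nth point h k] => //; rewrite setTI.
Qed.

Lemma measurable_prefix_event n (D : set (seq X)) :
  measurable [set w : play X | D (mkseq w n)].
Proof.
rewrite prefix_event_cylinders; apply: fin_bigcup_measurable => // h _.
exact: measurable_cylinder.
Qed.

End PrefixEvents.

(** * Expectation over histories of fixed length, as a finite sum *)

Section Expectation.
Variables (R : realType) (X : finPointedType).
Variable p : seq X -> X -> R.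
Hypothesis p_ge0 : forall h x, 0 <= p h x.
Hypothesis p_sum1 : forall h, \sum_(x : X) p h x = 1.

Definition expect n (F : seq X -> R) : R :=
  \sum_(t : n.-tuple X) path_prob p t * F t.

Lemma path_prob_rcons h x : path_prob p (rcons h x) = path_prob p h * p h x.
Proof.
rewrite /path_prob size_rcons big_ord_recr/= nth_rcons ltnn eqxx.
rewrite -cats1 take_size_cat//; congr (_ * _); apply: eq_bigr => k _.
by rewrite nth_cat ltn_ord takel_cat// ltnW.
Qed.

Lemma expect0 F : expect 0 F = F [::].
Proof.
rewrite /expect (bigD1 [tuple])//= big1 ?addr0.
  by rewrite /path_prob big_ord0 mul1r.
by move=> t /eqP[]; exact: tuple0.
Qed.

(** Tower property: condition on the first [n] letters, then average over the last one. *)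
Lemma expectS n F :
  expect n.+1 F = expect n (fun h => \sum_x p h x * F (rcons h x)).
Proof.
rewrite /expect; under [RHS]eq_bigr do rewrite mulr_sumr.
rewrite pair_bigA /=.
have lastK (t : n.+1.-tuple X) :
    rcons (belast (thead t) (behead t)) (last (thead t) (behead t)) = t.
  by rewrite -lastI; case/tupleP: t => x t; rewrite theadE.
rewrite (reindex (fun u : n.-tuple X * X => [tuple of rcons u.1 u.2])) /=.
  by apply: eq_bigr => u _; rewrite path_prob_rcons mulrA.
exists (fun t : n.+1.-tuple X =>
  ([tuple of belast (thead t) (behead t)], last (thead t) (behead t))).
  move=> [t x] _; set r := [tuple of rcons t x].
  have /rcons_inj[e1 e2] : rcons (belast (thead r) (behead r))
    (last (thead r) (behead r)) = rcons t x by rewrite lastK.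
  by congr (_, _) => //; apply: val_inj.
by move=> t _; apply: val_inj; rewrite /= lastK.
Qed.

Lemma sum_kernel_cst h a : \sum_x p h x * a = a.
Proof. by rewrite -mulr_suml p_sum1 mul1r. Qed.

Lemma expect_cst n a : expect n (fun=> a) = a.
Proof.
elim: n => [|n IH]; first by rewrite expect0.
rewrite expectS -[RHS]IH; congr expect; apply/funext => h.
exact: sum_kernel_cst.
Qed.

Lemma expectD n F G : expect n (F \+ G) = expect n F + expect n G.
Proof. by rewrite /expect -big_split; apply: eq_bigr => t _; rewrite mulrDr. Qed.

Lemma expectZ n a F : expect n (fun h => a * F h) = a * expect n F.
Proof. by rewrite /expect mulr_sumr; apply: eq_bigr => t _; rewrite mulrCA. Qed.

Lemma le_expect n F G : (forall h, F h <= G h) -> expect n F <= expect n G.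
Proof.
move=> FG; apply: ler_sum => t _; apply: ler_wpM2l => //.
exact: prodr_ge0.
Qed.

(** Bridge from the measure on plays to [expect]: the event is a finite disjoint union of
    cylinders. *)
Lemma prefix_event_prob (P : probability (play X) R) n (D : pred (seq X)) :
  (forall h, P (cylinder h) = (path_prob p h)%:E) ->
  P [set w | D (mkseq w n)] = (expect n (fun h => (D h)%:R))%:E.
Proof.
move=> PE; rewrite (prefix_event_cylinders n D).
rewrite measure_fin_bigcup//=.
- transitivity (\sum_(h : n.-tuple X | D h) P (cylinder h))%E.
    apply/esym/bigfs; first exact: index_enum_uniq.
    by move=> h _; rewrite mem_index_enum.
  rewrite -sumEFin big_mkcond; apply: eq_bigr => h _.
  by case: (D h); rewrite ?mulr1 ?mulr0// PE.
- move=> h h' _ _ [w []]; rewrite /cylinder /mkset !size_tuple => -> e.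
  exact: val_inj.
- by move=> h _; exact: measurable_cylinder.
Qed.

End Expectation.

(** * The walk in the simplex over [J] *)

Section Drift.
Variables (R : realType) (X : finPointedType) (J : finType).
Variables (g : X -> R) (d c : R) (nu : dist R J).
Hypothesis g_le1 : forall x, `|g x| <= 1.
Hypothesis d_gt0 : 0 < d.
Hypothesis c_le : forall x, c <= g x ^+ 2.

Definition heavy (m : J -> R) : pred (J * J) :=
  fun ij => [&& ij.1 != ij.2, d < m ij.1 & d < m ij.2].

(** The pair is picked from [m] alone, before [x] is seen; this makes the increment linear in [g x]
    with coefficients fixed by the past. *)
Definition transfer (m : J -> R) (x : X) : J -> R :=
  if [pick ij | heavy m ij] is Some ij
  then fun k => m k + d * g x * ((k == ij.1)%:R - (k == ij.2)%:R)
  else m.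

Definition state (h : seq X) : J -> R := foldl transfer nu h.

Definition unsettled (h : seq X) : bool := [exists ij, heavy (state h) ij].

Lemma state_rcons h x : state (rcons h x) = transfer (state h) x.
Proof. exact: foldl_rcons. Qed.

Lemma sum_indicator (i : J) (F : J -> R) : \sum_k F k * (k == i)%:R = F i.
Proof.
rewrite (bigD1 i)//= eqxx mulr1 big1 ?addr0// => k /negbTE ->.
by rewrite mulr0.
Qed.

(** A step moves at most [d], and only between coordinates that exceed [d]. *)
Lemma state_ge0 h j : 0 <= state h j.
Proof.
elim/last_ind: h j => [|h x IH] j; first exact: dist_ge0.
rewrite state_rcons /transfer; case: pickP => // -[i k] /and3P[/= ik di dk].
have [dg1 dg2] : - d <= d * g x /\ d * g x <= d.
  by apply/andP; rewrite -ler_norml normrM gtr0_norm// ler_piMr// ltW.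
rewrite -/(state h); have := IH j; have [->|ji] := eqVneq j i.
  rewrite (negbTE ik) subr0 mulr1 => _; lra.
case: eqVneq => [->|_] /=; first by rewrite sub0r mulrN1 => _; lra.
by rewrite subrr mulr0 addr0.
Qed.

Lemma state_sum1 h : \sum_j state h j = 1.
Proof.
elim/last_ind: h => [|h x IH]; first exact: dist_sum1.
rewrite state_rcons /transfer; case: pickP => // -[i k] _.
rewrite big_split/= IH -mulr_sumr sumrB.
have H l : \sum_(j : J) (j == l)%:R = 1 :> R.
  by rewrite -[RHS](sum_indicator l (fun=> 1)); apply: eq_bigr => *; rewrite mul1r.
by rewrite !H subrr mulr0 addr0.
Qed.

Lemma state_le1 h j : state h j <= 1.
Proof.
rewrite -(state_sum1 h) (bigD1 j)//= lerDl.
by apply: sumr_ge0 => k _; exact: state_ge0.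
Qed.

Lemma state_sqr_le1 h : \sum_j state h j ^+ 2 <= 1.
Proof.
rewrite -(state_sum1 h); apply: ler_sum => j _.
by rewrite expr2 ler_piMl ?state_ge0 ?state_le1.
Qed.

Lemma unsettled_rcons h x : unsettled (rcons h x) -> unsettled h.
Proof.
rewrite /unsettled state_rcons /transfer; case: pickP => // -[i k] H _.
by apply/existsP; exists (i, k).
Qed.

(** Expanding the two changed squares gives a term linear in [g x], which will vanish in mean, plus
    [2 * d ^+ 2 * g x ^+ 2]. The coefficient [b] must not depend on [x]. *)
Lemma transfer_sqr m : exists b, forall x,
  \sum_j m j ^+ 2 + b * g x + d ^+ 2 * c *+ 2 * [exists ij, heavy m ij]%:R
  <= \sum_j transfer m x j ^+ 2.
Proof.
rewrite /transfer; case: pickP => [[i k] H|H]; last first.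
  exists 0 => x; suff -> : [exists ij, heavy m ij] = false by rewrite mulr0 mul0r !addr0.
  by apply/existsP => -[ij]; rewrite H.
exists (d * (m i - m k) *+ 2) => x.
have -> : [exists ij, heavy m ij] by apply/existsP; exists (i, k).
move: H => /and3P[/= ik _ _].
have E j : (m j + d * g x * ((j == i)%:R - (j == k)%:R)) ^+ 2 =
   m j ^+ 2 + ((d * g x *+ 2 * m j + (d * g x) ^+ 2) * (j == i)%:R
     + ((d * g x) ^+ 2 - d * g x *+ 2 * m j) * (j == k)%:R).
  have [->|ji] := eqVneq j i; first by rewrite (negbTE ik) /=; ring.
  by case: (j == k) => /=; ring.
under [leRHS]eq_bigr do rewrite /= E.
rewrite !big_split /= !sum_indicator.
have := c_le x; have : 0 <= d ^+ 2 by exact: sqr_ge0.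
rewrite /= exprMn mulr1 => d2 cg.
have : d ^+ 2 * c <= d ^+ 2 * g x ^+ 2 by exact: ler_wpM2l.
lra.
Qed.

Definition decide (j0 : J) (h : seq X) : J :=
  [arg max_(k > j0) state h k]%O.

(** In a settled state every coordinate but the largest is at most [d], so the largest misses 1 by
    at most the sum of the others. Otherwise the trivial bound 1 applies. *)
Lemma decide_error j0 h j :
  `|(decide j0 h == j)%:R - state h j| <= #|J|%:R * d + (unsettled h)%:R.
Proof.
have s1 := state_le1 h.
have Jd0 : 0 <= #|J|%:R * d by rewrite mulr_ge0// ltW.
have s0 := state_ge0 h.
case: (boolP (unsettled h)) => [_|/existsPn H].
  have := s1 j; have := s0 j.
  by case: (_ == j) => /=; rewrite ler_norml => ? ?; apply/andP; split; lra.
rewrite addr0 /decide; case: arg_maxP => // i _ imax.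
have small k : k != i -> state h k <= d.
  move=> ki; rewrite leNgt; apply/negP => dk.
  have := H (k, i); rewrite /heavy /= ki dk /=.
  by rewrite (lt_le_trans dk)//; exact: imax.
have [<-|ij] := eqVneq i j; last first.
  rewrite sub0r normrN ger0_norm// (le_trans (small j _)) 1?eq_sym//.
  rewrite ler_peMl ?(ltW d_gt0)// ler1n; apply/card_gt0P; by exists j.
rewrite ger0_norm ?subr_ge0// -{1}(state_sum1 h) (bigD1 i)//= addrAC subrr add0r.
rewrite mulr_natl -sumr_const [leRHS](bigD1 i)//= ler_wpDl ?(ltW d_gt0)//.
exact: ler_sum.
Qed.

(** * Mean and energy of the walk *)

Section Martingale.
Variable p : seq X -> X -> R.
Hypothesis p_ge0 : forall h x, 0 <= p h x.
Hypothesis p_sum1 : forall h, \sum_(x : X) p h x = 1.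
Hypothesis p_mean0 : forall h, \sum_(x : X) p h x * g x = 0.

Lemma expect_state n j : expect p n (fun h => state h j) = nu j.
Proof.
elim: n => [|n IH]; first by rewrite expect0.
rewrite expectS -IH; congr expect; apply/funext => h.
under eq_bigr do rewrite state_rcons /transfer.
case: pickP => [[i k] _|_]; last by rewrite -mulr_suml p_sum1 mul1r.
under eq_bigr do rewrite mulrDr mulrA mulrCA.
rewrite big_split/= -mulr_suml p_sum1 mul1r -mulr_suml -mulr_sumr p_mean0.
by rewrite mulr0 mul0r addr0.
Qed.

Lemma expect_unsettled n : 0 <= c ->
  n%:R * (d ^+ 2 * c *+ 2) * expect p n (fun h => (unsettled h)%:R) <= 1.
Proof.
move=> c0; have k0 : 0 <= d ^+ 2 * c *+ 2 by rewrite mulrn_wge0// mulr_ge0// sqr_ge0.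
set k := d ^+ 2 * c *+ 2 in k0 *.
suff H : n%:R * k * expect p n (fun h => (unsettled h)%:R) <=
         expect p n (fun h => \sum_j state h j ^+ 2).
  rewrite (le_trans H)// -[leRHS](expect_cst p_sum1 n); apply: le_expect => // h.
  exact: state_sqr_le1.
elim: n => [|n IH].
  by rewrite !mul0r expect0; apply: sumr_ge0 => j _; exact: sqr_ge0.
(* A settled walk is frozen, so the last unsettled probability bounds all earlier ones from
   below. *)
have decr : expect p n.+1 (fun h => (unsettled h)%:R) <=
            expect p n (fun h => (unsettled h)%:R).
  rewrite expectS; apply: le_expect => // h.
  rewrite -[leRHS](sum_kernel_cst p_sum1 h); apply: ler_sum => x _.
  apply: ler_wpM2l => //; rewrite ler_nat.
  by case: (boolP (unsettled _)) => // /unsettled_rcons ->.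
apply: (@le_trans _ _ (n.+1%:R * k * expect p n (fun h => (unsettled h)%:R))).
  by apply: ler_wpM2l => //; rewrite mulr_ge0.
rewrite -natr1 2!mulrDl mul1r.
apply: le_trans (lerD IH (lexx _)) _.
rewrite -expectZ -expectD expectS; apply: le_expect => // h /=.
have [b Hb] := transfer_sqr (state h).
set a := leLHS.
(* Adding the mean-zero term [b * g x] lets [transfer_sqr] be applied letter by letter. *)
have -> : a = \sum_x p h x * (a + b * g x).
  under eq_bigr do rewrite mulrDr mulrCA.
  by rewrite big_split/= sum_kernel_cst// -mulr_sumr p_mean0 mulr0 addr0.
apply: ler_sum => x _; rewrite state_rcons; apply: ler_wpM2l => //.
by rewrite addrAC; exact: Hb.
Qed.

Lemma decide_prob_error j0 n j : 0 < c -> (0 < n)%N ->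
  `|expect p n (fun h => (decide j0 h == j)%:R) - nu j| <=
  #|J|%:R * d + (n%:R * (d ^+ 2 * c *+ 2))^-1.
Proof.
move=> c0 n0; set F := fun h => (decide j0 h == j)%:R.
set G := fun h => #|J|%:R * d + (unsettled h)%:R.
have EG : expect p n G <= #|J|%:R * d + (n%:R * (d ^+ 2 * c *+ 2))^-1.
  rewrite /G (expectD p n (fun=> _)) expect_cst// lerD2l.
  rewrite -[leRHS]mul1r ler_pdivlMr 1?mulrC ?expect_unsettled ?(ltW c0)//.
  by rewrite mulr_gt0 ?ltr0n// pmulrn_lgt0// mulr_gt0// exprn_gt0.
apply: le_trans EG; rewrite -(expect_state n j) ler_norml.
have FG h : - G h <= F h - state h j <= G h.
  by rewrite -ler_norml; exact: decide_error.
rewrite -mulN1r -[- expect _ _ _]mulN1r -!expectZ -expectD.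
by apply/andP; split; apply: le_expect => // h /=; rewrite !mulN1r;
  case/andP: (FG h).
Qed.

End Martingale.
End Drift.

(** * The centred indicator of a letter *)

Section Bias.
Variables (R : realType) (A : finType).

Definition bias (q : dist R A) (a0 a : A) : R := (a == a0)%:R - q a0.

Lemma dist_le1 (q : dist R A) a : q a <= 1.
Proof.
rewrite -(dist_sum1 q) (bigD1 a)//= lerDl.
by apply: sumr_ge0 => i _; exact: dist_ge0.
Qed.

Lemma dist_lt1 (q : dist R A) a : (1 < #|A|)%N -> (forall b, 0 < q b) -> q a < 1.
Proof.
move=> A1 q0; have /card_gt0P[b] : (0 < #|predC1 a|)%N.
  by rewrite cardC1 -subn1 subn_gt0.
move=> ba; rewrite -(dist_sum1 q) (bigD1 a)//= ltrDl (bigD1 b)//=.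
by rewrite ltr_pwDl// sumr_ge0// => i _; exact: dist_ge0.
Qed.

Lemma bias_mean0 (q : dist R A) a0 : \sum_a q a * bias q a0 a = 0.
Proof.
under eq_bigr do rewrite mulrBr.
by rewrite sumrB sum_indicator -mulr_suml dist_sum1 mul1r subrr.
Qed.

Lemma bias_le1 (q : dist R A) a0 a : `|bias q a0 a| <= 1.
Proof.
have := dist_ge0 q a0; have := dist_le1 q a0; rewrite /bias ler_norml.
by case: (_ == _) => /= ? ?; apply/andP; split; lra.
Qed.

(** The absolute value is [q a0] or [1 - q a0]; both lie in [0, 1], so their product is below
    either. *)
Lemma bias_ge (q : dist R A) a0 a : q a0 * (1 - q a0) <= `|bias q a0 a|.
Proof.
have q0 := dist_ge0 q a0; have q1 := dist_le1 q a0; rewrite /bias.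
by case: (_ == _) => /=; [rewrite ger0_norm ?subr_ge0//; nra
                         |rewrite sub0r normrN ger0_norm//; nra].
Qed.

End Bias.

(** * Mechanisms stopping at a fixed time *)

Section PrefixMechanism.
Variables (A1 A2 : finPointedType) (J : finType) (T : nat).
Variable out : seq (A1 * A2)%type -> J.

Lemma constant_stopping_time :
  stopping_time (fun _ : play (A1 * A2)%type => Some T).
Proof.
by move=> t /=; exact: (@filtration_prefix_event _ 0 t (fun=> (T <= t)%N)).
Qed.

Lemma prefix_stopped_measurable (B : set J) :
  stopped_algebra (fun _ : play (A1 * A2)%type => Some T)
    ((fun w => out (mkseq w T)) @^-1` B).
Proof.
split => [|t /=]; first exact: (measurable_prefix_event T (out @^-1` B)).
have [Tt|tT] := boolP (T <= t)%N.
  rewrite (_ : _ `&` _ = [set w | (out @^-1` B) (mkseq w T)]).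
    exact: filtration_prefix_event.
  by apply/seteqP; split => w //=; case.
rewrite (_ : _ `&` _ = [set w | set0 (mkseq w 0)]).
  exact: filtration_prefix_event.
by apply/seteqP; split => w //=; case.
Qed.

Definition prefix_mechanism : mechanism A1 A2 J :=
  Mechanism constant_stopping_time prefix_stopped_measurable.

Lemma prefix_mechanism_length (R : realType) :
  length_at_most R prefix_mechanism T.
Proof.
move=> s1 s2; rewrite -[RHS](@probability_setT _ _ _ (play_prob s1 s2)).
by congr (play_prob _ _ _); apply/seteqP; split => w //=; rewrite leqnn.
Qed.

Lemma prefix_mechanism_prob (R : realType) (s1 : strategy R A1 A2 A1)
    (s2 : strategy R A1 A2 A2) j :
  mech_prob prefix_mechanism s1 s2 j =
  expect (next_prob s1 s2) T (fun h => (out h == j)%:R).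
Proof.
rewrite /mech_prob.
have -> : [set w | mech_out prefix_mechanism w = j] =
          [set w : play _ | out (mkseq w T) == j].
  by apply/seteqP; split => w /= /eqP.
by rewrite (prefix_event_prob T (fun h => out h == j) (play_probE s1 s2)).
Qed.

End PrefixMechanism.

(** * Choice of parameters and conclusion *)

Theorem theorem2p4 (R : realType) (A1 A2 : finPointedType) (J : finType)
    (hA1 : (1 < #|A1|)%N) (hA2 : (1 < #|A2|)%N) (hJ : (1 < #|J|)%N)
    (s1 : strategy R A1 A2 A1) (s2 : strategy R A1 A2 A2)
    (s1_stationary : stationary s1) (s2_stationary : stationary s2)
    (s1_full : full_support s1) (s2_full : full_support s2)
    (nu : dist R J) (eps : R) (eps_gt0 : 0 < eps) :
  exists M : mechanism A1 A2 J,
    (exists T : nat, length_at_most R M T) /\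
    secure_implements M s1 s2 nu eps.
Proof.
have /card_gt0P[j0 _] : (0 < #|J|)%N by exact: ltnW.
pose q1 := s1 [::]; pose q2 := s2 [::].
pose u := bias q1 point; pose v := bias q2 point.
pose g (x : A1 * A2) := u x.1 * v x.2.
pose e (A : finType) (q : dist R A) a : R := q a * (1 - q a).
have e_gt0 (A : finType) (q : dist R A) a :
    (1 < #|A|)%N -> (forall b, 0 < q b) -> 0 < e A q a.
  by move=> ? ?; rewrite mulr_gt0// subr_gt0 dist_lt1.
have e1 : 0 < e _ q1 point by apply: e_gt0 => // b; exact: s1_full.
have e2 : 0 < e _ q2 point by apply: e_gt0 => // b; exact: s2_full.
pose c := (e _ q1 point * e _ q2 point) ^+ 2.
have c_gt0 : 0 < c by rewrite exprn_gt0// mulr_gt0.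
have g_le1 x : `|g x| <= 1 by rewrite normrM mulr_ile1 ?bias_le1.
have c_le x : c <= g x ^+ 2.
  rewrite -[leRHS]real_normK ?num_real//; apply: lerXn2r; rewrite ?nnegrE//.
    by rewrite mulr_ge0 ?ltW.
  by rewrite normrM ler_pM ?bias_ge// ltW.
(* The rounding error [#|J|%:R * d] takes one half of [eps]; [T] is chosen so that the unsettled
   probability takes the other half. *)
pose d := eps / 2 / #|J|%:R.
have J_gt0 : 0 < #|J|%:R :> R by rewrite ltr0n ltnW.
have d_gt0 : 0 < d by rewrite !divr_gt0.
pose k := d ^+ 2 * c *+ 2.
have k_gt0 : 0 < k by rewrite pmulrn_lgt0// mulr_gt0// exprn_gt0.
pose T := (Num.truncn ((eps / 2 * k)^-1)).+1.
have Tk : (T%:R * k)^-1 <= eps / 2.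
  have h : 0 < eps / 2 * k by rewrite mulr_gt0// divr_gt0.
  rewrite -[leLHS]mul1r ler_pdivrMr ?mulr_gt0 ?ltr0n//.
  rewrite mulrCA -ler_pdivrMr// mul1r ltW//.
  exact: truncnS_gt.
exists (prefix_mechanism T (decide g d nu j0)).
split; first by exists T; exact: prefix_mechanism_length.
have robust t1 t2 :
    (forall h, \sum_x next_prob t1 t2 h x * g x = 0) ->
    implements (prefix_mechanism T (decide g d nu j0)) t1 t2 nu eps.
  move=> mean0; apply: bigmax_le => [|j _]; first exact: ltW.
  rewrite prefix_mechanism_prob.
  apply: le_trans (decide_prob_error nu g_le1 d_gt0 c_le (next_prob_ge0 t1 t2)
    (next_prob_sum1 t1 t2) mean0 j0 j c_gt0 (ltn0Sn _)) _.
  rewrite [leRHS]splitr lerD// /d mulrC divfK// gt_eqF//.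
have mean (t1 : strategy R A1 A2 A1) (t2 : strategy R A1 A2 A2) h :
    \sum_x next_prob t1 t2 h x * g x =
    (\sum_a t1 h a * u a) * (\sum_b t2 h b * v b).
  rewrite big_distrlr pair_bigA /=; apply: eq_bigr => x _.
  by rewrite /next_prob /g mulrACA.
(* Stationarity identifies the honest law after [h] with the law at [[::]], against which [u] or [v]
   is centred. *)
split=> t; apply: robust => h; rewrite mean.
  by rewrite (s2_stationary h [::]) [X in _ * X]bias_mean0 mulr0.
by rewrite (s1_stationary h [::]) [X in X * _]bias_mean0 mul0r.
Qed.
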